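(* Let $A,B$ be quantum systems of fixed finite dimensions $d_A,d_B$. The entanglement generation rate is bounded over states and Hamiltonians with bounded variance: for every $b>0$ there is a constant $M$ such that $|\Gamma(\psi,H)|\le M$ for all pure states $|\psi\rangle$ of $AB$ and all Hermitian operators $H$ on $A\otimes B$ with $\langle\psi|H^2|\psi\rangle-\langle\psi|H|\psi\rangle^2\le b$.
   Context: For a pure bipartite state $|\psi\rangle$ and a Hermitian $H$ on $A\otimes B$, $\Gamma(\psi,H):=\frac{d}{dt}E\big(e^{-iHt}|\psi\rangle\langle\psi|e^{iHt}\big)\big|_{t=0}$, where $E$ is the relative entropy of entanglement; on pure states it equals the entanglement entropy $-\mathrm{Tr}(\rho_A\log\rho_A)$, $\rho_A=\mathrm{Tr}_B|\psi\rangle\langle\psi|$. *)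

(* Defs.v *)
(* MathComp-Analysis; the scalars are R[i] for an arbitrary R : realType. *)
From HB Require Import structures.
From mathcomp Require Export all_boot all_order all_algebra.
From mathcomp Require Export spectral sesquilinear.
From mathcomp Require Export mxtens complex.
From mathcomp Require Export boolp classical_sets functions reals topology.
From mathcomp Require Export normedtype derive exp trigo.
Import numFieldNormedType.Exports.

Set Implicit Arguments.
Unset Strict Implicit.
Unset Printing Implicit Defensive.

Import Order.TTheory GRing.Theory Num.Theory.
Local Open Scope ring_scope.
Local Open Scope sesquilinear_scope.
Local Open Scope complex_scope.

Section Quantum.
Variable R : realType.
Local Notation C := R[i].

(* Functional calculus f(A) = P^* diag(f(a_1), ..., f(a_n)) P, where
   A = P^* diag(a_1, ..., a_n) P with P unitary. It is meant for Hermitian A,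
   whose eigenvalues a_k are real, so that taking Re loses nothing. *)
Definition herm_fun (n : nat) (f : R -> C) (A : 'M[C]_n) : 'M[C]_n :=
  (spectralmx A)^t* *m diag_mx (map_mx (fun a => f (complex.Re a)) (spectral_diag A))
    *m spectralmx A.

(* exp(i t H) *)
Definition expi_mx (n : nat) (t : R) (H : 'M[C]_n) : 'M[C]_n :=
  herm_fun (fun x => cos (t * x) +i* sin (t * x)) H.

(* ln 0 = 0 in the library, which implements the convention 0 log 0 = 0 in
   the entropy below. *)
Definition log_mx (n : nat) (A : 'M[C]_n) : 'M[C]_n :=
  herm_fun (fun x => (ln x)%:C) A.

Definition is_pure_state (n : nat) (psi : 'cV[C]_n) : Prop :=
  psi^t* *m psi = 1%:M.

Definition projector (n : nat) (psi : 'cV[C]_n) : 'M[C]_n := psi *m psi^t*.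

(* <psi|A|psi>, which is real for Hermitian A *)
Definition expectation (n : nat) (psi : 'cV[C]_n) (A : 'M[C]_n) : R :=
  complex.Re ((psi^t* *m A *m psi) 0 0).

Definition variance (n : nat) (psi : 'cV[C]_n) (A : 'M[C]_n) : R :=
  expectation psi (A *m A) - expectation psi A ^+ 2.

(* The basis vector e_i (x) f_j of the composite system has index
   mxtens_index (i, j), as for the Kronecker product of the library. *)
Definition partial_trace_B (dA dB : nat) (rho : 'M[C]_(dA * dB)) : 'M[C]_dA :=
  \matrix_(i, i') \sum_(j < dB) rho (mxtens_index (i, j)) (mxtens_index (i', j)).

Definition von_neumann_entropy (n : nat) (rho : 'M[C]_n) : R :=
  - complex.Re (\tr (rho *m log_mx rho)).

(* The value of the relative entropy of entanglement on a pure state rho of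
   AB; it is only ever evaluated at pure states. *)
Definition entanglement_entropy (dA dB : nat) (rho : 'M[C]_(dA * dB)) : R :=
  von_neumann_entropy (partial_trace_B rho).

(* exp(-i H t) |psi><psi| exp(i H t) *)
Definition evolved_state (n : nat) (psi : 'cV[C]_n) (H : 'M[C]_n) (t : R) :
    'M[C]_n :=
  expi_mx (- t) H *m projector psi *m expi_mx t H.

Definition entanglement_along (dA dB : nat) (psi : 'cV[C]_(dA * dB))
    (H : 'M[C]_(dA * dB)) (t : R) : R :=
  entanglement_entropy (evolved_state psi H t).

Definition Gamma (dA dB : nat) (psi : 'cV[C]_(dA * dB))
    (H : 'M[C]_(dA * dB)) : R :=
  derive1 (entanglement_along psi H) 0.

End Quantum.

(* Main.v *)
(* Write psi_t = exp(-iHt) psi as a matrix X_t (rows indexed by A), so that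
   rho_t = X_t X_t^* has entropy sum_j eta(mu_j), with eta x = - x ln x and
   mu_j the eigenvalues of rho_t. If v_i, l_i are the eigenvectors and
   eigenvalues of rho_0 and w_j those of rho_t, then p_ij = |<v_i, w_j>|^2 is
   doubly stochastic, hence
     S(rho_t) - S(rho_0) = sum_i (sum_j p_ij eta(mu_j) - eta(l_i)),
   where sum_j p_ij mu_j = |X_t^* v_i|^2 and
   sum_j p_ij (mu_j - l_i)^2 = |(rho_t - rho_0) v_i|^2 = O(t^2).
   This gives differentiability without perturbation theory of eigenvalues:
   if l_i > 0, the tangent line of eta at l_i is accurate up to
   (mu_j - l_i)^2 / l_i; if l_i = 0, then X_0^* v_i = 0, so the mean of the
   mu_j is O(t^2), and by concavity the mean of the eta(mu_j) is O(|t|^(3/2)).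
   The derivative is - sum_i (ln l_i + 1) a_i', with a_i' = 2 Re <z_i, z_i'>,
   |z_i|^2 = l_i, and z_i' read off from -iHpsi. Replacing H by H - <H> changes
   z_i' by an imaginary multiple of z_i and does not affect a_i'; then
   |z_i'|^2 is at most the variance b, so |a_i'| <= sqrt l_i (1 + b), and
   |ln l + 1| sqrt l is bounded on [0, 1]. *)
Require Import Defs.
From mathcomp Require Import ring lra.
Import Order.TTheory GRing.Theory Num.Theory.
Import numFieldNormedType.Exports.

Set Implicit Arguments.
Unset Strict Implicit.
Unset Printing Implicit Defensive.

Local Open Scope ring_scope.
Local Open Scope classical_set_scope.
Local Open Scope complex_scope.
Local Open Scope sesquilinear_scope.

(** * Estimates for [eta] and its averages, and a remainder criterion for derivatives *)

Section RealInequalities.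
Variable R : realType.
Implicit Types (x y s t : R).

Lemma ln_leB1 x : 0 < x -> ln x <= x - 1.
Proof.
move=> x0; have := @le_ln1Dx R (x - 1).
by rewrite [1 + _]addrC subrK; apply; lra.
Qed.

Definition eta x : R := - (x * ln x).

Lemma eta0 : eta 0 = 0.
Proof. by rewrite /eta mul0r oppr0. Qed.

(** The middle term is [y * (ln x - ln y) + y - x]; apply [ln u <= u - 1] at [u = x / y] for the
    upper bound and at [u = y / x] for the lower one. At [y = 0] the lower bound is an equality. *)
Lemma eta_tangent x y : 0 < x -> 0 <= y ->
  - ((y - x) ^+ 2 / x) <= eta y - eta x + (ln x + 1) * (y - x) <= 0.
Proof.
move=> x0; rewrite le_eqVlt => /predU1P[<-|y0].
  rewrite eta0 /eta sub0r sqrrN expr2 mulfK ?gt_eqF//; lra.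
have yx : ln y - ln x <= y / x - 1.
  by rewrite -ln_div ?posrE//; apply: ln_leB1; rewrite divr_gt0.
have xy : ln x - ln y <= x / y - 1.
  by rewrite -ln_div ?posrE//; apply: ln_leB1; rewrite divr_gt0.
have -> : eta y - eta x + (ln x + 1) * (y - x) =
          y * (ln x - ln y) + y - x by rewrite /eta; ring.
apply/andP; split.
  have -> : - ((y - x) ^+ 2 / x) = - (y * (y / x - 1)) + y - x.
    by field; rewrite gt_eqF.
  rewrite lerD2r lerD2r -mulrN ler_pM2l//; lra.
have : y * (ln x - ln y) <= y * (x / y - 1) by rewrite ler_pM2l.
have -> : y * (x / y - 1) = x - y by field; rewrite gt_eqF.
lra.
Qed.

Lemma eta_geNsqr y : 0 <= y -> - y ^+ 2 <= eta y.
Proof.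
rewrite le_eqVlt => /predU1P[<-|y0]; first by rewrite eta0 expr0n oppr0.
rewrite /eta lerN2 expr2 ler_pM2l//; have := ln_leB1 y0; lra.
Qed.

Lemma eta_average (I : finType) (p m : I -> R) x :
  (forall i, 0 <= p i) -> (forall i, 0 <= m i) -> \sum_i p i = 1 -> 0 < x ->
  `|\sum_i p i * eta (m i) - eta x + (ln x + 1) * (\sum_i p i * m i - x)|
    <= (\sum_i p i * (m i - x) ^+ 2) / x.
Proof.
move=> p0 m0 p1 x0.
have -> : \sum_i p i * eta (m i) - eta x + (ln x + 1) * (\sum_i p i * m i - x) =
    \sum_i p i * (eta (m i) - eta x + (ln x + 1) * (m i - x)).
  have pc c : c = \sum_i p i * c by rewrite -mulr_suml p1 mul1r.
  rewrite {1}[eta x]pc [X in _ * (_ - X)]pc -!sumrB mulr_sumr.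
  by rewrite -big_split; apply: eq_bigr => i _ /=; ring.
rewrite mulr_suml; apply: le_trans (ler_norm_sum _ _ _) _.
apply: ler_sum => i _; rewrite normrM ger0_norm// -mulrA ler_wpM2l//.
have /andP[h1 h2] := eta_tangent x0 (m0 i).
by rewrite ler0_norm// lerNl.
Qed.

(** The [m i] are not assumed to be at most 1, so [eta (m i)] may be negative; the second moment
    controls by how much. *)
Lemma eta_average_ge0 (I : finType) (p m : I -> R) :
  (forall i, 0 <= p i) -> (forall i, 0 <= m i) ->
  - (\sum_i p i * (m i) ^+ 2) <= \sum_i p i * eta (m i).
Proof.
move=> p0 m0; rewrite -sumrN; apply: ler_sum => i _.
by rewrite -mulrN ler_wpM2l// eta_geNsqr.
Qed.

Lemma eta_average_le (I : finType) (p m : I -> R) x :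
  (forall i, 0 <= p i) -> (forall i, 0 <= m i) -> \sum_i p i = 1 -> 0 < x ->
  \sum_i p i * eta (m i) <= - ((\sum_i p i * m i) * ln x) + x.
Proof.
move=> p0 m0 p1 x0.
have -> : - ((\sum_i p i * m i) * ln x) + x = \sum_i p i * (- (m i * ln x) + x).
  have pc c : c = \sum_i p i * c by rewrite -mulr_suml p1 mul1r.
  rewrite [X in _ + X]pc mulr_suml -sumrN -big_split.
  by apply: eq_bigr => i _ /=; ring.
apply: ler_sum => i _; rewrite ler_wpM2l//.
have /andP[_ h2] := eta_tangent x0 (m0 i).
have := m0 i; move: h2; rewrite {2}/eta; lra.
Qed.

(** Take the tangent at [x = |t|^2] and put [s = sqrt |t|]. Then [- ln x = 4 * - ln s <= 4 / s], so
    a mean of at most [c * s^4] contributes [4 * c * s^3], and [x = s^4 <= s^3] accounts for the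
    [+ 1]. *)
Lemma eta_average_sqr (I : finType) (p m : I -> R) c t :
  (forall i, 0 <= p i) -> (forall i, 0 <= m i) -> \sum_i p i = 1 ->
  0 < `|t| <= 1 -> \sum_i p i * m i <= c * `|t| ^+ 2 ->
  \sum_i p i * eta (m i) <= (4 * c + 1) * (`|t| * Num.sqrt `|t|).
Proof.
move=> p0 m0 p1 /andP[t0 t1] ac.
pose s := Num.sqrt `|t|; have ts : `|t| = s ^+ 2 by rewrite sqr_sqrtr// ltW.
have s0 : 0 < s by rewrite sqrtr_gt0.
have s1 : s <= 1 by rewrite -sqrtr1 ler_wsqrtr.
have a0 : 0 <= \sum_i p i * m i by apply: sumr_ge0 => i _; apply: mulr_ge0.
apply: le_trans (eta_average_le p0 m0 p1 (exprn_gt0 2 t0)) _.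
rewrite -/s ts in ac *; rewrite -!exprM -exprSr in ac *.
rewrite lnXn// mulrDl; apply: lerD; last first.
  by rewrite mul1r; apply: ler_wiXn2l => //; apply: ltW.
have ls : - ln s <= s^-1.
  by rewrite -lnV ?posrE// ltW// ln_sublinear// invr_gt0.
have ls0 : 0 <= - ln s by rewrite oppr_ge0 ln_le0.
have -> : - ((\sum_i p i * m i) * (ln s *+ 4)) =
    4 * ((\sum_i p i * m i) * - ln s) by ring.
rewrite -mulrA ler_pM2l//.
apply: le_trans (ler_pM a0 ls0 ac ls) _.
rewrite le_eqVlt; apply/orP; left; apply/eqP; field.
by rewrite gt_eqF.
Qed.

(** With [s = sqrt x] the product is at most [(2 * - ln s + 1) * s]; then [- ln s * s <= 1] and
    [s <= 1] give [2 + 1]. *)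
Lemma ln_sqrt_bound x : 0 < x <= 1 -> `|ln x + 1| * Num.sqrt x <= 3.
Proof.
move=> /andP[x0 x1].
pose s := Num.sqrt x; have xs : x = s ^+ 2 by rewrite sqr_sqrtr// ltW.
have s0 : 0 < s by rewrite sqrtr_gt0.
have s1 : s <= 1 by rewrite -sqrtr1 ler_wsqrtr.
rewrite -/s xs lnXn//.
have ls : - ln s <= s^-1.
  by rewrite -lnV ?posrE// ltW// ln_sublinear// invr_gt0.
have ls1 : - ln s * s <= 1 by rewrite -ler_pdivlMr// mul1r.
have ls0 : ln s <= 0 by rewrite ln_le0.
apply: (@le_trans _ _ ((2 * - ln s + 1) * s)); last by lra.
rewrite ler_pM2r// ler_norml mulr2n; lra.
Qed.

Lemma is_derive_remainder (f : R -> R) (D C : R) :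
  (forall t, 0 < `|t| <= 1 ->
    `|f t - f 0 - t * D| <= C * (`|t| * Num.sqrt `|t|)) ->
  is_derive (0 : R) (1 : R) f D.
Proof.
move=> H.
have L : (fun h : R => h^-1 *: ((f \o shift (0 : R)) (h *: (1 : R)) - f 0))
     @ (0 : R)^' --> D.
  apply/cvgrPdist_le => e e0.
  near=> t.
  have t0 : t != 0 by near: t; exact: nbhs_dnbhs_neq.
  have t1 : `|t| <= 1.
    near: t; apply: nbhs_dnbhs.
    by apply: (@nbhs0_le R R); apply: ltr01.
  (* This makes [(|C| + 1) * sqrt |t| <= e]; the [+ 1] keeps the divisor positive when [C = 0]. *)
  have t2 : `|t| <= (e / (`|C| + 1)) ^+ 2.
    near: t; apply: nbhs_dnbhs.
    apply: (@nbhs0_le R R); rewrite exprn_gt0// divr_gt0//.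
    by rewrite ltr_wpDl.
  have nt : 0 < `|t| by rewrite normr_gt0.
  have -> : t *: (1 : R) = t by rewrite /GRing.scale /= mulr1.
  rewrite /= /GRing.scale /= addr0 -normrN.
  have -> : - (D - t^-1 * (f t - f 0)) = (f t - f 0 - t * D) / t by field.
  rewrite normrM normfV ler_pdivrMr//.
  apply: le_trans (H t _) _; first by rewrite nt.
  rewrite mulrCA mulrC ler_pM2r//.
  apply: (@le_trans _ _ ((`|C| + 1) * Num.sqrt `|t|)).
    by rewrite ler_wpM2r// ?sqrtr_ge0//; apply: le_trans (ler_norm _) _; lra.
  have C0 : 0 < `|C| + 1 by rewrite ltr_wpDl.
  rewrite mulrC -ler_pdivlMr//.
  have r0 : 0 <= e / (`|C| + 1) by rewrite ltW// divr_gt0.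
  by rewrite -(ger0_norm r0) -(sqrtr_sqr (e / _)) ler_wsqrtr.
have [dv dE] : derivable f 0 1 /\ 'D_1 f 0 = D.
  by split; [apply/cvg_ex; exists D | exact: cvg_lim].
exact: DeriveDef.
Unshelve. all: by end_near.
Qed.

End RealInequalities.

(** * Squared moduli, spectral decomposition and overlaps of two eigenbases *)

Section Spectral.
Variable R : realType.
Local Notation C := R[i].

Definition nsq (z : C) : R := complex.Re z ^+ 2 + complex.Im z ^+ 2.

Lemma nsqE (z : C) : (nsq z)%:C = z * Num.conj z.
Proof. by rewrite /nsq add_Re2_Im2 normCK. Qed.

Lemma nsq_ge0 z : 0 <= nsq z.
Proof. by rewrite addr_ge0 ?sqr_ge0. Qed.

Lemma nsq_eq0 z : nsq z = 0 -> z = 0.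
Proof.
move=> z0; apply/eqP; rewrite -normr_eq0 -sqrf_eq0.
by rewrite normCK -nsqE z0.
Qed.

Lemma nsqM z w : nsq (z * w) = nsq z * nsq w.
Proof. by case: z w => [a b] [c d]; rewrite /nsq /=; ring. Qed.

Lemma nsq_real (x : R) : nsq x%:C = x ^+ 2.
Proof. by rewrite /nsq /= expr0n addr0. Qed.

Definition rownsq m n (A : 'M[C]_(m, n)) i : R := \sum_j nsq (A i j).

Lemma trmxCM m n p (A : 'M[C]_(m, n)) (B : 'M[C]_(n, p)) :
  (A *m B)^t* = B^t* *m A^t*.
Proof. by rewrite trmx_mul map_mxM. Qed.

Lemma rownsqE m n (A : 'M[C]_(m, n)) i :
  (A *m A^t*) i i = (rownsq A i)%:C.
Proof.
rewrite mxE rmorph_sum; apply: eq_bigr => j _.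
by rewrite !mxE /= nsqE.
Qed.

Lemma rownsq_unitary m n (A : 'M[C]_(m, n)) (W : 'M[C]_n) i :
  W \is unitarymx -> rownsq (A *m W) i = rownsq A i.
Proof.
move=> Wu; apply: (@complexI R); rewrite -!rownsqE trmxCM mulmxA mulmxtVK//.
Qed.

Lemma sum_rownsq_unitary m n (A : 'M[C]_(m, n)) (W : 'M[C]_m) :
  W \is unitarymx -> \sum_i rownsq (W *m A) i = \sum_i rownsq A i.
Proof.
move=> Wu; apply: (@complexI R); rewrite !rmorph_sum /=.
have E k (B : 'M[C]_(m, k)) :
    \sum_i (rownsq B i)%:C = \tr (B *m B^t*).
  by apply: eq_bigr => i _; rewrite rownsqE.
rewrite !E trmxCM mulmxA mxtrace_mulC !mulmxA.
by have /unitarymxP/mulmx1C -> := Wu; rewrite mul1mx.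
Qed.

Lemma colnsq_unitary n (M : 'M[C]_n) j :
  M \is unitarymx -> \sum_i nsq (M i j) = 1.
Proof.
move=> /unitarymxP/mulmx1C/matrixP/(_ j j); rewrite !mxE eqxx => h.
apply: (@complexI R); apply: etrans h; rewrite rmorph_sum.
by apply: eq_bigr => i _; rewrite !mxE /= mulrC -nsqE.
Qed.

Definition eigval n (A : 'M[C]_n) i : R := complex.Re (spectral_diag A 0 i).

Lemma hermsymmx_trmxC n (A : 'M[C]_n) : A \is hermsymmx -> A^t* = A.
Proof. by move=> /is_hermitianmxP; rewrite expr0 scale1r. Qed.

Lemma gram_herm m n (X : 'M[C]_(m, n)) : X *m X^t* \is hermsymmx.
Proof.
by apply/is_hermitianmxP; rewrite expr0 scale1r trmxCM trmxCK.
Qed.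

Definition diagR n (f : 'I_n -> R) : 'M[C]_n := diag_mx (\row_i (f i)%:C).

Lemma diagR_conj m n (M : 'M[C]_(m, n)) f i :
  (M *m diagR f *m M^t*) i i = (\sum_j nsq (M i j) * f j)%:C.
Proof.
rewrite mxE rmorph_sum; apply: eq_bigr => j _.
by rewrite /diagR mul_mx_diag !mxE rmorphM /= nsqE mulrAC.
Qed.

Lemma rownsq_diagR n (M : 'M[C]_n) f g i :
  rownsq (M *m diagR f - diagR g *m M) i =
  \sum_j nsq (M i j) * (f j - g i) ^+ 2.
Proof.
apply: eq_bigr => j _; rewrite /diagR mul_mx_diag mul_diag_mx !mxE.
by rewrite mulrC -mulrBl -rmorphB nsqM nsq_real mulrC.
Qed.

Lemma herm_spectral n (A : 'M[C]_n) : A \is hermsymmx ->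
  A = (spectralmx A)^t* *m diagR (eigval A) *m spectralmx A.
Proof.
move=> Ah; have dE : spectral_diag A = \row_i (eigval A i)%:C.
  apply/rowP => i; rewrite mxE.
  have /mxOverP/(_ 0 i) := hermitian_spectral_diag_real Ah.
  by move/RRe_real.
have /hermitian_normalmx/orthomx_spectralP := Ah.
by rewrite (invmx_unitary (spectral_unitarymx A)) /diagR -dE.
Qed.

Lemma spectral_conj n (A : 'M[C]_n) : A \is hermsymmx ->
  spectralmx A *m A *m (spectralmx A)^t* = diagR (eigval A).
Proof.
move=> Ah; rewrite {2}(herm_spectral Ah) -!mulmxA.
have /unitarymxP -> := spectral_unitarymx A.
rewrite mulmx1 mulmxA.
by have /unitarymxP -> := spectral_unitarymx A; rewrite mul1mx.
Qed.

Lemma entropy_eigval n (A : 'M[C]_n) : A \is hermsymmx ->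
  von_neumann_entropy A = \sum_i eta (eigval A i).
Proof.
move=> Ah; rewrite /von_neumann_entropy /log_mx /herm_fun.
set P := spectralmx A; set L := diag_mx _.
rewrite !mulmxA mxtrace_mulC !mulmxA spectral_conj//.
rewrite /diagR /L mulmx_diag mxtrace_diag raddf_sum /= -sumrN.
apply: eq_bigr => i _; rewrite !mxE /eta /eigval.
by rewrite /= mulr0 subr0.
Qed.

Section Overlap.
Variables (n : nat) (A B : 'M[C]_n).
Hypotheses (Ah : A \is hermsymmx) (Bh : B \is hermsymmx).
Local Notation V := (spectralmx A).
Local Notation W := (spectralmx B).

(** These are the weights [p_ij]: the eigenvectors are the columns of [V^t*] and [W^t*], so each
    entry of [V *m W^t*] is an inner product of two of them. *)
Definition overlap i j : R := nsq ((V *m W^t*) i j).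

Let U := V *m W^t*.

Let Uu : U \is unitarymx.
Proof. by rewrite mul_unitarymx ?trmxC_unitary ?spectral_unitarymx. Qed.

Lemma overlap_ge0 i j : 0 <= overlap i j.
Proof. exact: nsq_ge0. Qed.

Lemma overlap_row i : \sum_j overlap i j = 1.
Proof.
apply: (@complexI R); rewrite -[LHS]/((rownsq U i)%:C) -rownsqE.
by have /unitarymxP -> := Uu; rewrite mxE eqxx.
Qed.

Lemma overlap_col j : \sum_i overlap i j = 1.
Proof. exact: colnsq_unitary. Qed.

Lemma overlap_mean i :
  (\sum_j overlap i j * eigval B j)%:C = (V *m B *m V^t*) i i.
Proof.
have -> : V *m B *m V^t* = U *m diagR (eigval B) *m U^t*.
  by rewrite {1}(herm_spectral Bh) /U trmxCM trmxCK !mulmxA.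
by rewrite diagR_conj.
Qed.

(** Factor [V *m (B - A)] as [U D_B - D_A U] times [W], with [D_A], [D_B] the diagonal forms: the
    unitary [W] preserves row norms, and entry [(i, j)] of the first factor is [U i j] times an
    eigenvalue difference. *)
Lemma overlap_var i :
  \sum_j overlap i j * (eigval B j - eigval A i) ^+ 2 = rownsq (V *m (B - A)) i.
Proof.
have -> : V *m (B - A) = (U *m diagR (eigval B) - diagR (eigval A) *m U) *m W.
  rewrite mulmxBr mulmxBl; congr (_ - _).
    by rewrite {1}(herm_spectral Bh) /U !mulmxA.
  rewrite -mulmxA /U mulmxKtV ?spectral_unitarymx//.
  rewrite {2}(herm_spectral Ah) !mulmxA.
  by have /unitarymxP -> := spectral_unitarymx A; rewrite mul1mx.
by rewrite rownsq_unitary ?spectral_unitarymx// rownsq_diagR.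
Qed.

(** Since the columns of [overlap] sum to 1, the entropy of [B] can be spread over the eigenvectors
    of [A]; the two spectra are compared without being matched. *)
Lemma entropy_sub : von_neumann_entropy B - von_neumann_entropy A =
  \sum_i (\sum_j overlap i j * eta (eigval B j) - eta (eigval A i)).
Proof.
rewrite !entropy_eigval// sumrB; congr (_ - _); rewrite exchange_big /=.
by apply: eq_bigr => j _; rewrite -mulr_suml overlap_col mul1r.
Qed.

End Overlap.

Lemma gram_conj m n p (V : 'M[C]_(p, m)) (X : 'M[C]_(m, n)) i :
  (V *m (X *m X^t*) *m V^t*) i i = (rownsq (V *m X) i)%:C.
Proof. by rewrite -rownsqE trmxCM !mulmxA. Qed.

Lemma gram_eigval m n (X : 'M[C]_(m, n)) i :
  eigval (X *m X^t*) i = rownsq (spectralmx (X *m X^t*) *m X) i.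
Proof.
apply: (@complexI R); rewrite -gram_conj spectral_conj ?gram_herm//.
by rewrite /diagR !mxE eqxx mulr1n.
Qed.

Lemma rownsq_ge0 m n (X : 'M[C]_(m, n)) i : 0 <= rownsq X i.
Proof. by apply: sumr_ge0 => j _; apply: nsq_ge0. Qed.

End Spectral.

(** * Quadratic bounds for sine and cosine by the mean value theorem *)

Section Trigo.
Variable R : realType.

Lemma norm_le_derive (f df : R -> R) (K x : R) : f 0 = 0 ->
  (forall y : R, is_derive y (1 : R) f (df y)) ->
  (forall y, `|y| <= `|x| -> `|df y| <= K) -> `|f x| <= K * `|x|.
Proof.
move=> f0 fd fK.
have cf a b : {within `[a, b], continuous f}.
  apply: continuous_subspaceT => y; apply: differentiable_continuous.
  by apply/derivable1_diffP; case: (fd y).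
have [x0|x0|->] := ltgtP x 0; last by rewrite f0 !normr0 mulr0.
- have [y] := MVT x0 (fun y _ => fd y) (cf _ _).
  rewrite in_itv /= => /andP[xy y0]; rewrite f0 !sub0r => e.
  rewrite -normrN e normrM (normrN x) ler_wpM2r//; apply: fK.
  by rewrite !ltr0_norm// lerN2 ltW.
- have [y] := MVT x0 (fun y _ => fd y) (cf _ _).
  rewrite in_itv /= => /andP[y0 yx]; rewrite f0 !subr0 => ->.
  rewrite normrM ler_wpM2r//; apply: fK.
  by rewrite !gtr0_norm// ltW.
Qed.

Lemma norm_cosB1 (x : R) : `|cos x - 1| <= `|x| ^+ 2.
Proof.
have sin_le (y : R) : `|sin y| <= `|y|.
  rewrite -[leRHS]mul1r; apply: (@norm_le_derive (@sin R) (@cos R)).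
    exact: sin0.
  by move=> z _; rewrite ler_norml cos_geN1 cos_le1.
apply: (@norm_le_derive (fun y => cos y - 1) (fun y => - sin y)).
- by rewrite cos0 subrr.
- by move=> y; rewrite -[X in is_derive _ _ _ X]subr0; apply: is_deriveB.
- by move=> y yx; rewrite normrN (le_trans (sin_le y)).
Qed.

Lemma norm_sinB (x : R) : `|sin x - x| <= `|x| ^+ 2.
Proof.
apply: (@norm_le_derive (fun y => sin y - y) (fun y => cos y - 1)).
- by rewrite sin0 subrr.
- move=> y yx; apply: le_trans yx; rewrite -[leRHS]mul1r.
  apply: (@norm_le_derive (fun y => cos y - 1) (fun y => - sin y)).
  + by rewrite cos0 subrr.
  + by move=> z; rewrite -[X in is_derive _ _ _ X]subr0; apply: is_deriveB.
  + by move=> z _; rewrite normrN ler_norml sin_geN1 sin_le1.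
Qed.

End Trigo.

(** * Order symbols at [t = 0] *)

Section BigO.
Variable R : realType.
Local Notation C := R[i].
Implicit Types (f g : R -> C) (k l : nat).

(** The bound holds on the fixed window [|t| <= 1], so sums and products only combine constants,
    with no neighbourhoods to intersect. Order 0 means bounded on the window; positive order forces
    [f 0 = 0]. *)
Definition bigO k f := exists2 c : R, 0 <= c &
  forall t : R, `|t| <= 1 -> `|f t| <= (c * `|t| ^+ k)%:C.

Lemma bigO_eq k f g : bigO k f -> f =1 g -> bigO k g.
Proof. by move=> [c c0 h] e; exists c => // t t1; rewrite -e h. Qed.

Lemma bigO_const z : bigO 0 (fun=> z).
Proof.
have nz : (complex.Re `|z|)%:C = `|z| by rewrite RRe_real ?normr_real.
by exists (complex.Re `|z|) => [|t _]; rewrite ?mulr1 ?nz// -ler0c nz.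
Qed.

Lemma bigO_id : bigO 1 (fun t => t%:C).
Proof.
exists 1 => // t _; rewrite mul1r expr1 normc_def /= expr0n addr0.
by rewrite sqrtr_sqr.
Qed.

Lemma bigOW k l f : (l <= k)%N -> bigO k f -> bigO l f.
Proof.
move=> lk [c c0 h]; exists c => // t t1; apply: le_trans (h t t1) _.
by rewrite lecR ler_wpM2l// ler_wiXn2l.
Qed.

Lemma bigOD k f g : bigO k f -> bigO k g -> bigO k (fun t => f t + g t).
Proof.
move=> [c c0 h] [d d0 h']; exists (c + d); first exact: addr_ge0.
move=> t t1; apply: le_trans (ler_normD _ _) _.
by rewrite mulrDl rmorphD lerD ?h ?h'.
Qed.

Lemma bigOM k l f g : bigO k f -> bigO l g -> bigO (k + l) (fun t => f t * g t).
Proof.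
move=> [c c0 h] [d d0 h']; exists (c * d); first exact: mulr_ge0.
by move=> t t1; rewrite normrM exprD mulrACA rmorphM ler_pM ?h ?h'.
Qed.

Lemma bigO_conj k f : bigO k f -> bigO k (fun t => Num.conj (f t)).
Proof. by move=> [c c0 h]; exists c => // t t1; rewrite norm_conjC h. Qed.

Lemma bigO_sum k (I : finType) (f : I -> R -> C) :
  (forall i, bigO k (f i)) -> bigO k (fun t => \sum_i f i t).
Proof.
move=> h; elim: (index_enum _) => [|i s IH].
  exists 0 => // t _; rewrite big_nil normr0 mul0r//.
by apply: (bigO_eq (bigOD (h i) IH)) => t; rewrite big_cons.
Qed.

Lemma bigOMl k z f : bigO k f -> bigO k (fun t => z * f t).
Proof. exact: (bigOM (bigO_const z)). Qed.

Lemma bigOMr k z f : bigO k f -> bigO k (fun t => f t * z).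
Proof. by move=> h; rewrite -[k]addn0; exact: (bigOM h (bigO_const z)). Qed.

Lemma bigO_real k (f : R -> R) : bigO k (fun t => (f t)%:C) ->
  exists2 c : R, 0 <= c & forall t, `|t| <= 1 -> `|f t| <= c * `|t| ^+ k.
Proof.
move=> [c c0 h]; exists c => // t t1; move: (h t t1).
by rewrite normc_def /= expr0n addr0 sqrtr_sqr lecR.
Qed.

(** The real and imaginary remainders of [exp(-itx)] contribute [x ^+ 2] each. *)
Lemma bigO_phase (x : R) :
  bigO 2 (fun t =>
    (cos (- t * x) +i* sin (- t * x)) - 1 - t%:C * (- 'i * x%:C)).
Proof.
exists (2 * x ^+ 2) => [|t _]; first by rewrite mulr_ge0// sqr_ge0.
pose y := - t * x.
have -> : (cos (- t * x) +i* sin (- t * x)) - 1 - t%:C * (- 'i * x%:C) =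
    (cos y - 1)%:C + 'i * (sin y - y)%:C.
  rewrite -/y; simpc; apply/eqP; rewrite eq_complex /y /=.
  by apply/andP; split; apply/eqP; ring.
apply: le_trans (ler_normD _ _) _; rewrite normrM.
have nR (z : R) : `|z%:C| = `|z|%:C.
  by rewrite normc_def /= expr0n addr0 sqrtr_sqr.
have -> : `|'i : C| = 1 by rewrite normc_def /= expr0n add0r expr1n sqrtr1.
rewrite mul1r !nR -rmorphD lecR.
have -> : 2 * x ^+ 2 * `|t| ^+ 2 = `|y| ^+ 2 + `|y| ^+ 2.
  rewrite /y normrM normrN exprMn -(normrX 2 x) (ger0_norm (sqr_ge0 x)).
  by ring.
by rewrite lerD ?norm_cosB1 ?norm_sinB.
Qed.

End BigO.

(** * Differentiability of the entropy of a Gram matrix *)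

Section EntropyDerivative.
Variable R : realType.
Local Notation C := R[i].

(* The derivative of |z + t w|^2 at t = 0. *)
Definition dnsq (z w : C) : R :=
  (complex.Re z * complex.Re w + complex.Im z * complex.Im w) *+ 2.

Lemma dnsqE z w : (dnsq z w)%:C = z * Num.conj w + w * Num.conj z.
Proof.
case: z w => [a b] [c d]; rewrite /dnsq /=.
have -> : Num.conj (a +i* b) = a -i* b by [].
have -> : Num.conj (c +i* d) = c -i* d by [].
by simpc; apply/eqP; rewrite eq_complex /=; apply/andP; split; apply/eqP; ring.
Qed.

Lemma conj_real (x : R) : Num.conj (x%:C : C) = x%:C.
Proof. by apply/CrealP; rewrite complex_real. Qed.

Lemma dnsq0 w : dnsq 0 w = 0.
Proof. by rewrite /dnsq /= !mul0r addr0 mul0rn. Qed.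

(** An infinitesimal change of phase does not change the modulus; this is what permits replacing [H]
    by [H - <H>]. *)
Lemma dnsq_shift z w (m : R) : dnsq z (w - 'i * m%:C * z) = dnsq z w.
Proof. by case: z w => [a b] [c d]; rewrite /dnsq /=; ring. Qed.

(** AM-GM on real and imaginary parts, from the nonnegativity of the squares of [s * x + y] and
    [s * x - y]. The weight [s] stays free so that it can later be [1 / sqrt l]. *)
Lemma dnsq_bound z w (s : R) : 0 < s ->
  `|dnsq z w| <= s * nsq z + nsq w / s.
Proof.
move=> s0; case: z w => [a b] [c d]; rewrite /dnsq /nsq /=.
have amgm (x y : R) : `|x * y *+ 2| <= s * x ^+ 2 + y ^+ 2 / s.
  have p : 0 <= (s * x + y) ^+ 2 / s by rewrite divr_ge0 ?sqr_ge0// ltW.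
  have q : 0 <= (s * x - y) ^+ 2 / s by rewrite divr_ge0 ?sqr_ge0// ltW.
  have pE : (s * x + y) ^+ 2 / s = s * x ^+ 2 + y ^+ 2 / s + x * y *+ 2.
    by field; rewrite gt_eqF.
  have qE : (s * x - y) ^+ 2 / s = s * x ^+ 2 + y ^+ 2 / s - x * y *+ 2.
    by field; rewrite gt_eqF.
  by rewrite ler_norml; apply/andP; split; lra.
rewrite mulrnDl; apply: le_trans (ler_normD _ _) _.
apply: le_trans (lerD (amgm a c) (amgm b d)) _.
by rewrite mulrDr mulrDl; lra.
Qed.

Section ScalarExpansion.
Variables (z : R -> C) (z1 : C).
Hypothesis zO : bigO 2 (fun t => z t - z 0 - t%:C * z1).

Lemma bigO_expansion1 : bigO 1 (fun t => z t - z 0).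
Proof.
apply: bigO_eq (bigOD (bigOW (isT : (1 <= 2)%N) zO) (bigOMr z1 (@bigO_id R))) _.
by move=> t; ring.
Qed.

Lemma bigO_expansion0 : bigO 0 z.
Proof.
have := bigOD (bigOW (leq0n 1) bigO_expansion1) (bigO_const (z 0)).
move/bigO_eq; apply.
by move=> t; ring.
Qed.

Lemma bigO_nsq :
  bigO 2 (fun t => (nsq (z t) - nsq (z 0) - t * dnsq (z 0) z1)%:C).
Proof.
have A1 := bigO_expansion1.
have P1 := bigOM A1 (bigO_conj A1).
have P2 := bigOMr (Num.conj (z 0)) zO.
have P3 := bigOMl (z 0) (bigO_conj zO).
apply: bigO_eq (bigOD P1 (bigOD P2 P3)) _ => t.
rewrite [X in _ = X]rmorphB [X in _ = X - _]rmorphB [X in _ = _ - X]rmorphM /=.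
by rewrite dnsqE !nsqE !rmorphB rmorphM /= conj_real; ring.
Qed.

End ScalarExpansion.

Section Gram.
Variables (m n : nat) (X : R -> 'M[C]_(m, n)) (X1 : 'M[C]_(m, n)).
Hypothesis XO : forall i j, bigO 2 (fun t => X t i j - X 0 i j - t%:C * X1 i j).
Let rho t := X t *m (X t)^t*.
Let V := spectralmx (rho 0).

Lemma bigO_mulmx (M : 'M[C]_m) i j :
  bigO 2 (fun t => (M *m X t) i j - (M *m X 0) i j - t%:C * (M *m X1) i j).
Proof.
apply: bigO_eq (bigO_sum (fun k => bigOMl (M i k) (XO k j))) _ => t.
rewrite !mxE mulr_sumr -!sumrB; apply: eq_bigr => k _; ring.
Qed.

Lemma bigO_rownsq i : bigO 2 (fun t =>
  (rownsq (V *m X t) i - rownsq (V *m X 0) i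
    - t * \sum_j dnsq ((V *m X 0) i j) ((V *m X1) i j))%:C).
Proof.
apply: bigO_eq (bigO_sum (fun j => bigO_nsq (bigO_mulmx V i j))) _ => t.
by rewrite -rmorph_sum mulr_sumr -!sumrB.
Qed.

Lemma bigO_gram_diff i : bigO 2 (fun t => (rownsq (V *m (rho t - rho 0)) i)%:C).
Proof.
have D1 k l : bigO 1 (fun t => (rho t - rho 0) k l).
  have E j := bigOD
    (bigOM (bigO_expansion1 (XO k j)) (bigO_conj (bigO_expansion0 (XO l j))))
    (bigOMl (X 0 k j) (bigO_conj (bigO_expansion1 (XO l j)))).
  apply: bigO_eq (bigO_sum E) _ => t; rewrite !mxE -sumrB.
  by apply: eq_bigr => j _; rewrite !mxE !rmorphB /=; ring.
have D2 l : bigO 1 (fun t => (V *m (rho t - rho 0)) i l).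
  apply: bigO_eq (bigO_sum (fun k => bigOMl (V i k) (D1 k l))) _ => t.
  by rewrite mxE.
apply: bigO_eq (bigO_sum (fun l => bigOM (D2 l) (bigO_conj (D2 l)))) _ => t.
by rewrite rmorph_sum; apply: eq_bigr => l _; rewrite -nsqE.
Qed.

(** This is [a_i'], the velocity of the diagonal entry of [rho t] at the fixed vector [v_i], rather
    than of an eigenvalue of [rho t]. *)
Definition gram_velocity i : R :=
  \sum_j dnsq ((V *m X 0) i j) ((V *m X1) i j).

Lemma rownsq_eq0 k l (M : 'M[C]_(k, l)) i j : rownsq M i = 0 -> M i j = 0.
Proof.
move/eqP; rewrite psumr_eq0 => [|x _]; last exact: nsq_ge0.
by move/allP/(_ j (mem_index_enum _))/eqP/nsq_eq0.
Qed.

(** At a zero eigenvalue the row [z_i] vanishes, so its squared norm is at its minimum. The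
    convention [ln 0 = 0] is thus harmless in the derivative formula. *)
Lemma gram_velocity0 i : eigval (rho 0) i = 0 -> gram_velocity i = 0.
Proof.
rewrite /rho gram_eigval -/(rho 0) -/V => l0.
rewrite /gram_velocity big1// => j _.
by rewrite rownsq_eq0// dnsq0.
Qed.

Lemma sqr_le_mul_sqrt (t : R) : `|t| <= 1 -> `|t| ^+ 2 <= `|t| * Num.sqrt `|t|.
Proof.
move=> t1; rewrite expr2 ler_wpM2l//.
rewrite -{1}(sqr_sqrtr (normr_ge0 t)) expr2 ler_piMr ?sqrtr_ge0//.
by rewrite -sqrtr1 ler_wsqrtr.
Qed.

Lemma eigval_expansion i : exists c : R, forall t, 0 < `|t| <= 1 ->
  `|\sum_j overlap (rho 0) (rho t) i j * eta (eigval (rho t) j)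
    - eta (eigval (rho 0) i)
    - t * - ((ln (eigval (rho 0) i) + 1) * gram_velocity i)|
  <= c * (`|t| * Num.sqrt `|t|).
Proof.
have hh t : rho t \is hermsymmx by exact: gram_herm.
have eig0 t j : 0 <= eigval (rho t) j by rewrite gram_eigval rownsq_ge0.
have [c c0 hc] := bigO_real (bigO_rownsq i).
have [d d0 hd] := bigO_real (bigO_gram_diff i).
have mean t : \sum_j overlap (rho 0) (rho t) i j * eigval (rho t) j =
    rownsq (V *m X t) i.
  by apply: (@complexI R); rewrite overlap_mean// -gram_conj.
have lE : eigval (rho 0) i = rownsq (V *m X 0) i by rewrite gram_eigval.
have var t := overlap_var (hh 0) (hh t) i.
have row t := overlap_row (rho 0) (rho t) i.
have ov0 t := @overlap_ge0 _ _ (rho 0) (rho t) i.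
set l := eigval (rho 0) i in lE var *.
set v := gram_velocity i.
have : 0 <= l by exact: eig0.
rewrite le_eqVlt => /predU1P[l0|l0].
- have v0 : v = 0 by apply: gram_velocity0; rewrite -/l.
  (* [d] bounds the second moment in the lower estimate; [4 * c + 1] comes from [eta_average_sqr] in
     the upper one. *)
  exists (d + (4 * c + 1)) => t /[dup] /andP[t0 t1] t01.
  rewrite v0 -l0 eta0 mulr0 oppr0 mulr0 !subr0.
  have lo := eta_average_ge0 (ov0 t) (eig0 t).
  have up : \sum_j overlap (rho 0) (rho t) i j * eta (eigval (rho t) j)
      <= (4 * c + 1) * (`|t| * Num.sqrt `|t|).
    apply: eta_average_sqr => //.
    rewrite mean; have := hc t t1.
    rewrite -/(gram_velocity i) -/v v0 -lE -l0 mulr0 !subr0.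
    exact: le_trans (ler_norm _).
  have := hd t t1; rewrite -var -l0.
  under eq_bigr do rewrite subr0.
  move/(le_trans (ler_norm _)) => q.
  have s3 := sqr_le_mul_sqrt t1.
  have q' := le_trans q (ler_wpM2l d0 s3).
  have c40 : 0 <= 4 * c + 1 by rewrite addr_ge0// mulr_ge0.
  have s30 : 0 <= `|t| * Num.sqrt `|t| by rewrite mulr_ge0// sqrtr_ge0.
  have := mulr_ge0 c40 s30; have := mulr_ge0 d0 s30.
  rewrite mulrDl ler_norml => ? ?; apply/andP; split; lra.
(* [d / l] is the tangent-line error, [|ln l + 1| * c] the error of expanding the mean to first
   order. *)
- exists (d / l + `|ln l + 1| * c) => t /andP[t0 t1].
  have s3 := sqr_le_mul_sqrt t1.
  have := eta_average (ov0 t) (eig0 t) (row t) l0.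
  rewrite mean var => h1; have h2 := hc t t1.
  rewrite -/(gram_velocity i) -/v -lE in h2.
  have h3 : rownsq (V *m (rho t - rho 0)) i / l <= d / l * `|t| ^+ 2.
    rewrite mulrAC ler_pM2r ?invr_gt0//.
    exact: le_trans (ler_norm _) (hd t t1).
  set Y := \sum_j _ in h1 *.
  have -> : Y - eta l - t * - ((ln l + 1) * v) =
     (Y - eta l + (ln l + 1) * (rownsq (V *m X t) i - l)) -
     (ln l + 1) * (rownsq (V *m X t) i - l - t * v) by ring.
  apply: le_trans (ler_normB _ _) _.
  apply: (@le_trans _ _ ((d / l + `|ln l + 1| * c) * `|t| ^+ 2)).
    by rewrite [leRHS]mulrDl lerD// ?(le_trans h1)// normrM -mulrA ler_wpM2l.
  have dl : 0 <= d / l by rewrite divr_ge0// ltW.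
  by rewrite ler_wpM2l// addr_ge0// mulr_ge0.
Qed.

Lemma is_derive_gram_entropy :
  is_derive (0 : R) (1 : R) (fun t => von_neumann_entropy (rho t))
    (- \sum_i (ln (eigval (rho 0) i) + 1) * gram_velocity i).
Proof.
have [c hc] := choice eigval_expansion.
apply: (@is_derive_remainder _ _ _ (\sum_i c i)) => t t01.
rewrite entropy_sub ?gram_herm// -sumrN mulr_sumr -sumrB mulr_suml.
apply: le_trans (ler_norm_sum _ _ _) _.
by apply: ler_sum => i _; apply: hc.
Qed.

End Gram.
End EntropyDerivative.

(** * The unitary flow to first order, and the variance as a squared norm *)

Section Evolution.
Variable R : realType.
Local Notation C := R[i].

Lemma bigO_at0 k (f : R -> C) : bigO k.+1 f -> f 0 = 0.
Proof.
move=> [c _ /(_ 0)]; rewrite normr0 expr0n mulr0 => /(_ ler01).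
by rewrite normr_le0 => /eqP.
Qed.

(** Reshaping [psi] into its coefficient matrix turns the reduced state into a Gram matrix. *)
Definition state_mx (dA dB : nat) (psi : 'cV[C]_(dA * dB)) : 'M[C]_(dA, dB) :=
  \matrix_(i, j) psi (mxtens_index (i, j)) 0.

Lemma partial_trace_projector dA dB (psi : 'cV[C]_(dA * dB)) :
  partial_trace_B (projector psi) = state_mx psi *m (state_mx psi)^t*.
Proof.
apply/matrixP => i k; rewrite !mxE; apply: eq_bigr => j _.
by rewrite !mxE big_ord1 !mxE.
Qed.

Definition colsq n (v : 'cV[C]_n) : R := \sum_c nsq (v c 0).

Lemma colsqE n (v : 'cV[C]_n) : (v^t* *m v) 0 0 = (colsq v)%:C.
Proof.
rewrite mxE rmorph_sum; apply: eq_bigr => c _.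
by rewrite !mxE mulrC -nsqE.
Qed.

Lemma sum_rownsq_state_mx dA dB (psi : 'cV[C]_(dA * dB)) :
  \sum_i rownsq (state_mx psi) i = colsq psi.
Proof.
rewrite pair_big /= /colsq (reindex (@mxtens_index dA dB)) /=; last first.
  exists (@mxtens_unindex dA dB) => ? _.
    by rewrite mxtens_indexK.
  by rewrite mxtens_unindexK.
by apply: eq_bigr => -[i j] _; rewrite mxE.
Qed.

Section Flow.
Variables (n : nat) (psi : 'cV[C]_n) (H : 'M[C]_n).
Hypothesis Hh : H \is hermsymmx.

Lemma expi_mx_trmxC t : (expi_mx (- t) H)^t* = expi_mx t H.
Proof.
rewrite /expi_mx /herm_fun !trmxCM trmxCK mulmxA; congr (_ *m _ *m _).
rewrite tr_diag_mx map_diag_mx; congr diag_mx; apply/rowP => k; rewrite !mxE.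
have conjE (a b : R) : Num.conj (a +i* b : C) = a -i* b by [].
by rewrite mulNr cosN sinN [LHS]conjE opprK.
Qed.

Definition evolved_vector t : 'cV[C]_n := expi_mx (- t) H *m psi.

Lemma evolved_stateE t : evolved_state psi H t = projector (evolved_vector t).
Proof.
by rewrite /evolved_state /projector trmxCM expi_mx_trmxC !mulmxA.
Qed.

(** In the eigenbasis of [H] the flow multiplies each coordinate by a phase, so [bigO_phase] applies
    termwise. *)
Lemma bigO_evolved_vector c :
  bigO 2 (fun t => evolved_vector t c 0 - psi c 0
                   - t%:C * (- 'i * (H *m psi) c 0)).
Proof.
set P := spectralmx H.
have E k := bigOMl (P^t* c k)
  (bigOMr ((P *m psi) k 0) (bigO_phase (eigval H k))).
apply: bigO_eq (bigO_sum E) _ => t.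
have D (f : 'I_n -> C) :
    (P^t* *m diag_mx (\row_k f k) *m P *m psi) c 0 =
    \sum_k P^t* c k * (f k * (P *m psi) k 0).
  rewrite -!mulmxA mul_diag_mx mxE; apply: eq_bigr => k _.
  by rewrite [(\matrix_(_, _) _) _ _]mxE [(\row__ _) _ _]mxE.
have -> : evolved_vector t c 0 =
    \sum_k P^t* c k * ((cos (- t * eigval H k) +i* sin (- t * eigval H k))
                       * (P *m psi) k 0).
  rewrite -(D (fun k => cos (- t * eigval H k) +i* sin (- t * eigval H k))).
  rewrite /evolved_vector /expi_mx /herm_fun -/P.
  suff -> : map_mx
      (fun a : C => cos (- t * complex.Re a) +i* sin (- t * complex.Re a))
      (spectral_diag H) =
      \row_k (cos (- t * eigval H k) +i* sin (- t * eigval H k)) by [].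
  by apply/rowP => k; rewrite !mxE.
have -> : (H *m psi) c 0 = \sum_k P^t* c k * ((eigval H k)%:C * (P *m psi) k 0).
  by rewrite {1}(herm_spectral Hh) (D (fun k => (eigval H k)%:C)).
have -> : psi c 0 = \sum_k P^t* c k * (P *m psi) k 0.
  transitivity ((P^t* *m (P *m psi)) c 0); last by rewrite mxE.
  have /unitarymxP/mulmx1C e := spectral_unitarymx H.
  by rewrite mulmxA e mul1mx.
rewrite !mulr_sumr -!sumrB; apply: eq_bigr => k _; ring.
Qed.

(** The order-2 remainder vanishes at [t = 0], which gives the initial value without evaluating the
    exponential. *)
Lemma evolved_vector0 : evolved_vector 0 = psi.
Proof.
apply/colP => c; have := bigO_at0 (bigO_evolved_vector c).
by rewrite mul0r subr0 => /eqP; rewrite subr_eq0 => /eqP.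
Qed.

Lemma expectationE : (expectation psi H)%:C = (psi^t* *m H *m psi) 0 0.
Proof.
rewrite /expectation RRe_real//; apply/CrealP.
have e : (psi^t* *m H *m psi)^t* = psi^t* *m H *m psi.
  by rewrite !trmxCM trmxCK (hermsymmx_trmxC Hh) mulmxA.
by rewrite -[in RHS]e [in RHS]mxE [in RHS]mxE.
Qed.

(** With [m = <H>] and [|psi| = 1], each of the two cross terms is [- m^2] and [|m psi|^2 = m^2],
    which leaves [|H psi|^2 - m^2]. *)
Lemma variance_colsq : is_pure_state psi ->
  colsq (H *m psi - (expectation psi H)%:C *: psi) = variance psi H.
Proof.
move=> pure; rewrite /variance; set m := expectation psi H; set w := _ - _.
have mE : psi^t* *m H *m psi = m%:C%:M.
  by apply/matrixP => i j; rewrite !ord1 [RHS]mxE eqxx mulr1n /m expectationE.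
have HE : (H *m psi)^t* = psi^t* *m H by rewrite trmxCM (hermsymmx_trmxC Hh).
have wE : w^t* = psi^t* *m H - m%:C *: psi^t*.
  by rewrite /w linearB map_mxB linearZ map_mxZ /= conj_real HE.
have -> : expectation psi (H *m H) = colsq (H *m psi).
  by apply: (@complexI R); rewrite /expectation mulmxA -HE -mulmxA colsqE.
apply: (@complexI R); rewrite -colsqE wE.
have -> : (psi^t* *m H - m%:C *: psi^t*) *m w =
    (H *m psi)^t* *m (H *m psi) - (m ^+ 2)%:C%:M.
  rewrite /w mulmxBr !mulmxBl -!scalemxAl -!scalemxAr.
  rewrite [psi^t* *m (H *m psi)]mulmxA.
  rewrite mE pure HE rmorphXn /=; move: (m%:C) => c.
  by rewrite !scale_scalar_mx !mulr1 subrr subr0 expr2.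
by rewrite [LHS]mxE [X in _ + X]mxE colsqE [_%:M _ _]mxE eqxx mulr1n rmorphB.
Qed.

End Flow.

End Evolution.

(** * A bound uniform in the state and the Hamiltonian *)

Section Bound.
Variable R : realType.
Local Notation C := R[i].

Lemma rownsq_le_sum m n (A : 'M[C]_(m, n)) i : rownsq A i <= \sum_k rownsq A k.
Proof.
by rewrite (bigD1 i)//= lerDl sumr_ge0// => k _; exact: rownsq_ge0.
Qed.

(** The weight [1 / sqrt l] in [dnsq_bound] bounds the sum by [sqrt l * (1 + b)]; [ln_sqrt_bound]
    then plays [sqrt l] against the logarithm. If [l = 0], every [z j] vanishes. *)
Lemma log_velocity_bound (I : finType) (z w : I -> C) (l b : R) :
  \sum_j nsq (z j) = l -> l <= 1 -> \sum_j nsq (w j) <= b ->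
  `|(ln l + 1) * \sum_j dnsq (z j) (w j)| <= 3 * (1 + b).
Proof.
move=> zl l1 wb.
have l0 : 0 <= l by rewrite -zl sumr_ge0// => j _; exact: nsq_ge0.
have b0 : 0 <= b.
  by apply: le_trans wb; rewrite sumr_ge0// => j _; exact: nsq_ge0.
move: l0; rewrite le_eqVlt => /predU1P[l0|l0].
  rewrite big1 ?mulr0 ?normr0 ?mulr_ge0 ?addr_ge0// => j _.
  move/eqP: zl; rewrite -l0 psumr_eq0 => [|k _]; last exact: nsq_ge0.
  by move/allP/(_ j (mem_index_enum _))/eqP/nsq_eq0 => ->; rewrite dnsq0.
set s := Num.sqrt l.
have s0 : 0 < s by rewrite sqrtr_gt0.
have ls : l = s ^+ 2 by rewrite sqr_sqrtr// ltW.
have vb : `|\sum_j dnsq (z j) (w j)| <= s * (1 + b).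
  apply: le_trans (ler_norm_sum _ _ _) _.
  have si0 : 0 < s^-1 by rewrite invr_gt0.
  apply: le_trans (ler_sum _ (fun j _ => dnsq_bound (z j) (w j) si0)) _.
  rewrite big_split /= -mulr_sumr -mulr_suml zl invrK {1}ls expr2.
  rewrite mulKf ?gt_eqF//.
  by rewrite mulrDr mulr1 lerD2l mulrC ler_pM2l.
rewrite normrM; apply: le_trans (ler_wpM2l (normr_ge0 _) vb) _.
rewrite mulrA ler_wpM2r ?addr_ge0//; apply: ln_sqrt_bound.
by rewrite l0.
Qed.

End Bound.

(* The first conjunct says that the derivative defining Gamma exists (derive1
   is a total operator). *)
Theorem proposition2 (R : realType) (dA dB : nat) (b : R) (hb : 0 < b) :
  exists M : R,
    forall (psi : 'cV[R[i]]_(dA * dB)) (H : 'M[R[i]]_(dA * dB)),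
      is_pure_state psi ->
      H \is hermsymmx ->
      variance psi H <= b ->
      derivable (entanglement_along psi H) 0 1 /\ `|Gamma psi H| <= M.
Proof.
(* One summand [3 * (1 + b)] for each eigenvalue of the reduced state on [A]. *)
exists (\sum_(i < dA) 3 * (1 + b)) => psi H pure Hh varb.
pose X t := state_mx (evolved_vector psi H t).
pose v := H *m psi - (expectation psi H)%:C *: psi.
have X0E : X 0 = state_mx psi by rewrite /X evolved_vector0.
have XO i j : bigO 2 (fun t => X t i j - X 0 i j
    - t%:C * (state_mx (- 'i *: (H *m psi))) i j).
  apply: bigO_eq (bigO_evolved_vector psi Hh (mxtens_index (i, j))) _ => t.
  by rewrite X0E /X !mxE.
have entE : entanglement_along psi H =
    fun t => von_neumann_entropy (X t *m (X t)^t*).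
  apply/funext => t; rewrite /entanglement_along /entanglement_entropy /X.
  by rewrite -partial_trace_projector -evolved_stateE.
have [dE DE] := is_derive_gram_entropy XO.
rewrite /Gamma derive1E entE DE normrN; split; first exact: dE.
apply: le_trans (ler_norm_sum _ _ _) _; apply: ler_sum => i _.
rewrite /gram_velocity.
set V := spectralmx _.
have Vu : V \is unitarymx by exact: spectral_unitarymx.
(* Writing [H psi = v + <H> psi] splits off an imaginary multiple of the row [z_i], which
   [dnsq_shift] then removes. *)
have -> : V *m state_mx (- 'i *: (H *m psi)) =
    V *m state_mx (- 'i *: v) - ('i * (expectation psi H)%:C) *: (V *m X 0).
  rewrite X0E [X in _ - X]scalemxAr -[RHS]mulmxBr; congr (mulmx _ _).
  by apply/matrixP => k j; rewrite /v !mxE; move: (_%:C) => m; ring.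
under eq_bigr => j _ do rewrite [X in dnsq _ X]mxE [X in dnsq _ (_ + X)]mxE
  [X in dnsq _ (_ + - X)]mxE dnsq_shift.
have le_sum (Y : 'M[R[i]]_(dA, dB)) : rownsq (V *m Y) i <= \sum_k rownsq Y k.
  by rewrite -(sum_rownsq_unitary Y Vu); exact: rownsq_le_sum.
apply: log_velocity_bound.
- by rewrite gram_eigval.
- rewrite gram_eigval; apply: le_trans (le_sum _) _.
  by rewrite -(@lecR R) X0E sum_rownsq_state_mx -colsqE pure mxE eqxx.
(* One row is bounded by the total, which the unitary [V] preserves; [- 'i] has modulus 1, and what
   remains is the variance. *)
- apply: le_trans (le_sum _) _; rewrite sum_rownsq_state_mx.
  apply: le_trans varb; rewrite -(variance_colsq Hh pure).
  apply: ler_sum => c _; rewrite mxE nsqM -/v.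
  by rewrite /nsq /= oppr0 expr0n sqrrN expr1n add0r mul1r.
Qed.
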